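(* Let $\tau>0$ and let $\phi$ be a kernel of the form (K) below. Let $R$ be any finite product of factors $\Gamma(c\mp s)^{\pm1}$ (with various $c\in\mathbb{C}$ and independent signs). Then $R(s)\phi(s)=C\lambda^{-s}\phi_{\mathrm{new}}(s)$, where $\phi_{\mathrm{new}}$ is a kernel of the form (K) with the same $\tau,\alpha$, and $C,\lambda$ and the enlarged parameter lists are obtained by composing, factor by factor, the four insertion rules below. The multipliers of the following operators are all of this form (up to a constant and the indicated substitution in $s$): Erdélyi–Kober $I^{\gamma,\delta}_{\beta=1}$: $\frac{\Gamma(\gamma+1-s)}{\Gamma(\gamma+\delta+1-s)}$; Euler transform: $\Gamma(\gamma)\frac{\Gamma(\beta-s)}{\Gamma(\beta+\gamma-s)}$; Laplace transform: $\Gamma(s)$, with $s\mapsto1-s$; differentiation $d/dz$: $-s=-\frac{\Gamma(s+1)}{\Gamma(s)}$, with $s\mapsto s+1$. Moreover the product $\phi_1\phi_2$ of two kernels of the form (K) with a common $\tau$ is again of the form (K), with the parameter blocks concatenated and $\alpha=\alpha_1+\alpha_2$.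
   Context: For $\tau>0$, $G(z;\tau)$ is the Barnes double gamma function: the entire function $G(z;\tau)=\frac{z}{\tau}e^{c_1 z/\tau+c_2 z^2/(2\tau^2)}\prod_{(k,l)\in\mathbb{Z}_{\ge0}^2\setminus\{(0,0)\}}\big(1+\frac{z}{k\tau+l}\big)e^{-\frac{z}{k\tau+l}+\frac{z^2}{2(k\tau+l)^2}}$, with real constants $c_1,c_2$ (depending on $\tau$) uniquely determined by $G(z+1;\tau)=\Gamma(z/\tau)G(z;\tau)$ and $G(z+\tau;\tau)=(2\pi)^{(\tau-1)/2}\tau^{1/2-z}\Gamma(z)G(z;\tau)$. (K): for integers $0\le m\le q$, $0\le n\le p$, $\mathbf a\in\mathbb{C}^p$, $\mathbf b\in\mathbb{C}^q$, $\alpha\in\mathbb{C}$, $$\phi(s)=\phi^{m,n}_{p,q}\!\left(\begin{matrix}\mathbf a\\ \mathbf b\end{matrix}\middle|s\right)=\frac{\prod_{j=1}^{m}G(b_j-s;\tau)\prod_{j=1}^{n}G(1+\tau-a_j+s;\tau)}{\prod_{j=m+1}^{q}G(1+\tau-b_j+s;\tau)\prod_{j=n+1}^{p}G(a_j-s;\tau)}\,e^{\pi\alpha s^2/\tau}.$$ Numerator block: $a_1,\dots,a_n$, $b_1,\dots,b_m$; denominator block: $a_{n+1},\dots,a_p$, $b_{m+1},\dots,b_q$; order inside a block is immaterial, and concatenating blocks means joining numerator blocks with numerator blocks and denominator blocks with denominator blocks. Insertion rules, with $\kappa=(2\pi)^{(1-\tau)/2}$, for $R\phi=C\lambda^{-s}\phi_{\mathrm{new}}$: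 (1) $R=\Gamma(c-s)$: $C=\kappa\tau^{c-1/2}$, $\lambda=\tau$, add $a$-parameter $c$ (denominator) and $b$-parameter $c+\tau$ (numerator). (2) $R=\Gamma(c+s)$: $C=\kappa\tau^{c-1/2}$, $\lambda=\tau^{-1}$, add $a$-parameter $1-c$ (numerator) and $b$-parameter $1+\tau-c$ (denominator). (3) $R=1/\Gamma(c-s)$: $C=\kappa^{-1}\tau^{1/2-c}$, $\lambda=\tau^{-1}$, add $a$-parameter $c+\tau$ (denominator) and $b$-parameter $c$ (numerator). (4) $R=1/\Gamma(c+s)$: $C=\kappa^{-1}\tau^{1/2-c}$, $\lambda=\tau$, add $a$-parameter $1+\tau-c$ (numerator) and $b$-parameter $1-c$ (denominator). Adding a numerator $a$-parameter increments $n,p$; a denominator $a$-parameter increments $p$; a numerator $b$-parameter increments $m,q$; a denominator $b$-parameter increments $q$. *)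

(* Defs.v *)
From HB Require Import structures.
From mathcomp Require Import all_boot all_order all_algebra.
From mathcomp Require Import complex.
From mathcomp Require Import all_classical all_reals all_analysis.
Set Implicit Arguments.
Unset Strict Implicit.
Unset Printing Implicit Defensive.
Import Order.TTheory GRing.Theory Num.Theory.
Import numFieldNormedType.Exports.
Local Open Scope classical_set_scope.
Local Open Scope complex_scope.
Local Open Scope ring_scope.

Definition cexp (R : realType) (z : R[i]) : R[i] :=
  (expR (complex.Re z) * cos (complex.Im z)) +i*
  (expR (complex.Re z) * sin (complex.Im z)).

(* x ^ w = exp (w * ln x); meaningful only for x > 0 *)
Definition cpow (R : realType) (x : R) (w : R[i]) : R[i] :=
  cexp (w * (ln x)%:C).

(* Gauss's limit. At a pole the terms are eventually 0 (they are quotients by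
   0), so Gamma takes the value 0 there; hence (Gamma z)^-1 is the entire
   function 1 / Gamma at every z, its zeros included. *)
Definition Gamma (R : realType) (z : R[i]) : R[i] :=
  lim ((fun n : nat => (n`!)%:R * cpow n%:R z /
          \prod_(k < n.+1) (z + k%:R) : R[i]^o) @ \oo).

Definition Gamma_pole (R : realType) (z : R[i]) : Prop :=
  exists n : nat, z = - n%:R.

Definition barnes_factor (R : realType) (w z : R[i]) : R[i] :=
  (1 + z / w) * cexp (- (z / w) + z ^+ 2 / (2 * w ^+ 2)).

(* The product converges absolutely, so it may be exhausted by squares. *)
Definition barnes_product (R : realType) (tau : R) (c1 c2 : R) (z : R[i])
    : R[i] :=
  z / tau%:C *
  cexp (c1%:C * z / tau%:C + c2%:C * z ^+ 2 / (2 * tau%:C ^+ 2)) *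
  lim ((fun N : nat =>
          \prod_(k < N) \prod_(l < N | (k != 0 :> nat) || (l != 0 :> nat))
            barnes_factor (k%:R * tau%:C + l%:R) z : R[i]^o) @ \oo).

(* The two functional equations are the conditions that determine the constants
   c1 and c2. They are identities of meromorphic functions, hence required only
   off the poles of the Gamma factor, where Gamma has a dummy value. *)
Definition is_double_gamma (R : realType) (tau : R) (G : R[i] -> R[i])
    : Prop :=
  exists c1 c2 : R,
    [/\ forall z, G z = barnes_product tau c1 c2 z,
        forall z, ~ Gamma_pole (z / tau%:C) ->
          G (z + 1) = Gamma (z / tau%:C) * G z
      & forall z, ~ Gamma_pole z ->
          G (z + tau%:C) =
          cpow (2 * pi) ((tau - 1) / 2)%:C * cpow tau (2^-1 - z) *
          Gamma z * G z].

(* p and q are the lengths of the two lists; the first n entries of ka and the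
   first m entries of kb are the numerator blocks. *)
Record kernel_params (R : realType) := KernelParams {
  km : nat;
  kn : nat;
  ka : seq R[i];
  kb : seq R[i];
  km_le : (km <= size kb)%N;
  kn_le : (kn <= size ka)%N }.

Definition kernel_num (R : realType) (tau : R) (G : R[i] -> R[i])
    (k : kernel_params R) (s : R[i]) : R[i] :=
  (\prod_(0 <= j < km k) G ((kb k)`_j - s)) *
  (\prod_(0 <= j < kn k) G (1 + tau%:C - (ka k)`_j + s)).

Definition kernel_den (R : realType) (tau : R) (G : R[i] -> R[i])
    (k : kernel_params R) (s : R[i]) : R[i] :=
  (\prod_(km k <= j < size (kb k)) G (1 + tau%:C - (kb k)`_j + s)) *
  (\prod_(kn k <= j < size (ka k)) G ((ka k)`_j - s)).

Definition K_kernel (R : realType) (tau : R) (G : R[i] -> R[i]) (alpha : R[i])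
    (k : kernel_params R) (s : R[i]) : R[i] :=
  kernel_num tau G k s / kernel_den tau G k s *
  cexp (pi%:C * alpha * s ^+ 2 / tau%:C).

Definition add_a_num (R : realType) (c : R[i]) (k : kernel_params R) :=
  @KernelParams R (km k) (kn k).+1 (c :: ka k) (kb k) (km_le k) (kn_le k).

Definition add_b_num (R : realType) (c : R[i]) (k : kernel_params R) :=
  @KernelParams R (km k).+1 (kn k) (ka k) (c :: kb k) (km_le k) (kn_le k).

Lemma leq_size_rcons (T : Type) (n : nat) (s : seq T) (c : T) :
  (n <= size s)%N -> (n <= size (rcons s c))%N.
Proof. by rewrite size_rcons; exact: leqW. Qed.

Definition add_a_den (R : realType) (c : R[i]) (k : kernel_params R) :=
  @KernelParams R (km k) (kn k) (rcons (ka k) c) (kb k)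
    (km_le k) (leq_size_rcons c (kn_le k)).

Definition add_b_den (R : realType) (c : R[i]) (k : kernel_params R) :=
  @KernelParams R (km k) (kn k) (ka k) (rcons (kb k) c)
    (leq_size_rcons c (km_le k)) (kn_le k).

Definition cat_blocks (T : Type) (n1 n2 : nat) (s1 s2 : seq T) : seq T :=
  (take n1 s1 ++ take n2 s2) ++ (drop n1 s1 ++ drop n2 s2).

Lemma leq_size_cat_blocks (T : Type) (n1 n2 : nat) (s1 s2 : seq T) :
  (n1 <= size s1)%N -> (n2 <= size s2)%N ->
  (n1 + n2 <= size (cat_blocks n1 n2 s1 s2))%N.
Proof.
by move=> h1 h2; rewrite !size_cat !size_takel // leq_addr.
Qed.

Definition cat_params (R : realType) (k1 k2 : kernel_params R) :=
  @KernelParams R (km k1 + km k2) (kn k1 + kn k2)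
    (cat_blocks (kn k1) (kn k2) (ka k1) (ka k2))
    (cat_blocks (km k1) (km k2) (kb k1) (kb k2))
    (leq_size_cat_blocks (km_le k1) (km_le k2))
    (leq_size_cat_blocks (kn_le k1) (kn_le k2)).

(* The factors Gamma(c - s), Gamma(c + s), 1 / Gamma(c - s), 1 / Gamma(c + s),
   in this order. *)
Inductive gamma_factor (R : realType) :=
  | GammaMinus of R[i]
  | GammaPlus of R[i]
  | InvGammaMinus of R[i]
  | InvGammaPlus of R[i].

Definition factor_eval (R : realType) (f : gamma_factor R) (s : R[i]) : R[i] :=
  match f with
  | GammaMinus c => Gamma (c - s)
  | GammaPlus c => Gamma (c + s)
  | InvGammaMinus c => (Gamma (c - s))^-1
  | InvGammaPlus c => (Gamma (c + s))^-1
  end.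

Definition factor_regular (R : realType) (f : gamma_factor R) (s : R[i])
    : Prop :=
  match f with
  | GammaMinus c => ~ Gamma_pole (c - s)
  | GammaPlus c => ~ Gamma_pole (c + s)
  | InvGammaMinus _ | InvGammaPlus _ => True
  end.

Definition gamma_product (R : realType) (r : seq (gamma_factor R)) (s : R[i])
    : R[i] :=
  \prod_(f <- r) factor_eval f s.

Definition gamma_product_regular (R : realType) (r : seq (gamma_factor R))
    (s : R[i]) : Prop :=
  foldr (fun f P => factor_regular f s /\ P) True r.

Definition kappa (R : realType) (tau : R) : R[i] :=
  cpow (2 * pi) ((1 - tau) / 2)%:C.

Definition rule_C (R : realType) (tau : R) (f : gamma_factor R) : R[i] :=
  match f with
  | GammaMinus c | GammaPlus c => kappa tau * cpow tau (c - 2^-1)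
  | InvGammaMinus c | InvGammaPlus c => (kappa tau)^-1 * cpow tau (2^-1 - c)
  end.

Definition rule_lambda (R : realType) (tau : R) (f : gamma_factor R) : R :=
  match f with
  | GammaMinus _ | InvGammaPlus _ => tau
  | GammaPlus _ | InvGammaMinus _ => tau^-1
  end.

Definition rule_params (R : realType) (tau : R) (f : gamma_factor R)
    (k : kernel_params R) : kernel_params R :=
  match f with
  | GammaMinus c => add_a_den c (add_b_num (c + tau%:C) k)
  | GammaPlus c => add_a_num (1 - c) (add_b_den (1 + tau%:C - c) k)
  | InvGammaMinus c => add_a_den (c + tau%:C) (add_b_num c k)
  | InvGammaPlus c => add_a_num (1 + tau%:C - c) (add_b_den (1 - c) k)
  end.

Definition insert_C (R : realType) (tau : R) (r : seq (gamma_factor R))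
    : R[i] :=
  \prod_(f <- r) rule_C tau f.

Definition insert_lambda (R : realType) (tau : R) (r : seq (gamma_factor R))
    : R :=
  \prod_(f <- r) rule_lambda tau f.

Definition insert_params (R : realType) (tau : R) (r : seq (gamma_factor R))
    (k : kernel_params R) : kernel_params R :=
  foldr (rule_params tau) k r.

Definition erdelyi_kober_multiplier (R : realType) (gamma delta s : R[i])
    : R[i] :=
  Gamma (gamma + 1 - s) / Gamma (gamma + delta + 1 - s).

Definition euler_multiplier (R : realType) (beta gamma s : R[i]) : R[i] :=
  Gamma gamma * (Gamma (beta - s) / Gamma (beta + gamma - s)).

Definition laplace_multiplier (R : realType) (s : R[i]) : R[i] := Gamma s.

Definition derivative_multiplier (R : realType) (s : R[i]) : R[i] := - s.

(* Main.v *)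
Require Import Defs.
From mathcomp Require Import all_boot all_order all_algebra.
From mathcomp Require Import complex.
From mathcomp Require Import all_classical all_reals all_analysis.
From mathcomp Require Import ring lra.
Set Implicit Arguments.
Unset Strict Implicit.
Unset Printing Implicit Defensive.
Import Order.TTheory GRing.Theory Num.Theory.
Import numFieldNormedType.Exports.
Local Open Scope complex_scope.
Local Open Scope ring_scope.

(** The functional equation of the double gamma function in the direction tau
    reads, with z = c - s or z = c + s,
    [Gamma z = kappa * tau ^ (z - 1/2) * G (z + tau) / G z].
    Its right-hand side is a constant times [lambda ^ (- s)] times a quotient
    of two factors of the shape occurring in a kernel, so that multiplying a
    kernel by [Gamma z] adds one numerator and one denominator parameter, and
    multiplying by [1 / Gamma z] does the same with the roles exchanged. This
    is [factor_evalE]; the statement for a finite product of factors follows by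
    induction ([gamma_productM_K_kernel]). At a pole of [Gamma] the rule for
    [1 / Gamma z] reads [0 = 0], because the product defining [G] vanishes at
    the points -n ([G_at_pole]) and the dummy value of [Gamma] there is 0.

    Products of kernels are a rearrangement of finite products, together with
    the addition law of the exponential ([K_kernelM]).

    The only multiplier that is not a product of gamma factors by its very
    definition is that of the derivative, which requires
    [Gamma (s + 1) = s * Gamma s] and [Gamma s <> 0] off the poles. As [Gamma]
    is defined by Gauss's limit, both rest on the convergence of that limit to
    a nonzero number ([gauss_cvg_neq0]). Consecutive inverse terms of Gauss's
    sequence have the ratio
    [(1 + z / (n + 1)) * exp (- z * ln ((n + 1) / n)) = 1 + O(1 / n ^ 2)].
    The bound is taken in the telescoping form [C / n - C / (n + 1)], with
    which the convergence of a sequence of partial products reduces to monotone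
    convergence of real sequences ([cvg_complex_product]). This applies both to
    the sequence and to its inverse, and the two limits have product 1. *)

Local Notation normc := ComplexField.Normc.normc.

(** * Modulus and convergence in the complex numbers *)

Section ComplexModulus.
Variable R : realType.
Implicit Types z w : R[i].

Lemma normE z : `|z| = (normc z)%:C.
Proof. by rewrite normc_def; case: z. Qed.

Lemma normc_ge0 z : 0 <= normc z.
Proof. by case: z => a b; exact: sqrtr_ge0. Qed.

Lemma ler_normcD z w : normc (z + w) <= normc z + normc w.
Proof. exact: le_normcD. Qed.

Lemma normcC (x : R) : normc x%:C = `|x|.
Proof. by rewrite /= expr0n addr0 sqrtr_sqr. Qed.

Lemma ler_Re_normc z : `|complex.Re z| <= normc z.
Proof.
case: z => a b /=; rewrite -sqrtr_sqr ler_wsqrtr // lerDl; exact: sqr_ge0.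
Qed.

Lemma ler_Im_normc z : `|complex.Im z| <= normc z.
Proof.
case: z => a b /=; rewrite -sqrtr_sqr ler_wsqrtr // lerDr; exact: sqr_ge0.
Qed.

Lemma normc_le_ReIm z : normc z <= `|complex.Re z| + `|complex.Im z|.
Proof.
case: z => a b /=; rewrite -[leRHS]ger0_norm ?addr_ge0 // -sqrtr_sqr.
rewrite ler_wsqrtr // sqrrD !real_normK ?num_real //.
by have := mulr_ge0 (normr_ge0 a) (normr_ge0 b); lra.
Qed.

(** The topology of R[i] comes from its R[i]-valued norm: a positive radius is
    a positive real number seen in R[i]. *)
Lemma cvg_ReIm (u : nat -> R[i]) (a b : R) :
  ((fun n => complex.Re (u n)) @ \oo --> a)%classic ->
  ((fun n => complex.Im (u n)) @ \oo --> b)%classic ->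
  ((u : nat -> R[i]^o) @ \oo --> (a +i* b : R[i]^o))%classic.
Proof.
move=> /cvgrPdist_lt ua /cvgrPdist_lt ub; apply/cvgrPdist_lt => eps.
case: eps => e e'; rewrite ltcE /= => /andP[/eqP e'0 e0].
have e20 : 0 < e / 2 by lra.
near=> n.
have ha : `|a - complex.Re (u n)| < e / 2 by near: n; exact: ua.
have hb : `|b - complex.Im (u n)| < e / 2 by near: n; exact: ub.
rewrite [ltLHS]normE ltcE /= e'0 eqxx /=.
apply: le_lt_trans (normc_le_ReIm _) _.
by move: ha hb; case: (u n) => c d /= ha hb; lra.
Unshelve. all: by end_near.
Qed.

(** [x + d] is nonincreasing and bounded below, and so is [d]. *)
Lemma cvg_telescope (x d : nat -> R) :
  (forall n, 0 <= d n) -> (forall n, `|x n.+1 - x n| <= d n - d n.+1) ->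
  exists l : R, (x @ \oo --> l)%classic.
Proof.
move=> d0 xd.
have d_cvg : cvgn d.
  apply: nonincreasing_is_cvgn; last by exists 0 => _ [n _ <-].
  apply/nonincreasing_seqP => n.
  by have := xd n; have := normr_ge0 (x n.+1 - x n); lra.
have lo n : x 0%N - d 0%N <= x n - d n.
  elim: n => // n IH; apply: le_trans IH _.
  by have := xd n; rewrite ler_norml => /andP[]; lra.
have xd_cvg : cvgn (fun n => x n + d n).
  apply: nonincreasing_is_cvgn; last first.
    exists (x 0%N - d 0%N) => _ [n _ <-] /=.
    by have := lo n; have := d0 n; lra.
  apply/nonincreasing_seqP => n /=.
  by have := xd n; rewrite ler_norml => /andP[]; lra.
exists (limn (fun n => x n + d n) - limn d).
rewrite {1}(_ : x = (fun n => x n + d n) - d);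
  last by apply/funext => n /=; rewrite addrK.
exact: cvgB xd_cvg d_cvg.
Qed.

Lemma cvg_complex_telescope (u : nat -> R[i]) (d : nat -> R) :
  (forall n, 0 <= d n) -> (forall n, normc (u n.+1 - u n) <= d n - d n.+1) ->
  exists l : R[i]^o, ((u : nat -> R[i]^o) @ \oo --> l)%classic.
Proof.
move=> d0 ud.
have [|a ha] := @cvg_telescope (fun n => complex.Re (u n)) d d0.
  move=> n; apply: le_trans (ud n); apply: le_trans (ler_Re_normc _).
  by case: (u n.+1) (u n) => ? ? [].
have [|b hb] := @cvg_telescope (fun n => complex.Im (u n)) d d0.
  move=> n; apply: le_trans (ud n); apply: le_trans (ler_Im_normc _).
  by case: (u n.+1) (u n) => ? ? [].
by exists (a +i* b); exact: cvg_ReIm.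
Qed.

(** Convergence of a sequence of partial products [P] whose ratios differ from
    1 by at most the decrements of a nonnegative nonincreasing sequence [c]. *)
Lemma cvg_complex_product (P : nat -> R[i]) (c : nat -> R) :
  (forall n, 0 <= c n) ->
  (forall n, normc (P n.+1 - P n) <= normc (P n) * (c n - c n.+1)) ->
  (forall n, c n.+1 <= c n) ->
  exists l : R[i]^o, ((P : nat -> R[i]^o) @ \oo --> l)%classic.
Proof.
move=> c0 Pc cS.
pose M := normc (P 0%N) * expR (c 0%N).
have bnd n : normc (P n) <= normc (P 0%N) * expR (c 0%N - c n).
  elim: n => [|n IH]; first by rewrite subrr expR0 mulr1.
  have -> : P n.+1 = P n + (P n.+1 - P n) by rewrite addrC subrK.
  apply: le_trans (ler_normcD _ _) _.
  have h : normc (P n) + normc (P n.+1 - P n) <=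
           normc (P n) * expR (c n - c n.+1).
    have := ler_wpM2l (normc_ge0 (P n)) (expR_ge1Dx (c n - c n.+1)).
    by have := Pc n; rewrite [_ * (1 + _)]mulrDr mulr1; lra.
  apply: le_trans h _.
  have -> : c 0%N - c n.+1 = (c 0%N - c n) + (c n - c n.+1) by ring.
  by rewrite [in leRHS]expRD mulrA ler_wpM2r ?expR_ge0.
have bndM n : normc (P n) <= M.
  apply: le_trans (bnd n) _; rewrite ler_wpM2l ?normc_ge0 // ler_expR.
  by have := c0 n; lra.
have M0 : 0 <= M by apply: le_trans (normc_ge0 _) (bndM 0%N).
apply: (@cvg_complex_telescope P (fun n => M * c n)) => n.
  exact: mulr_ge0.
apply: le_trans (Pc n) _; rewrite -mulrBr ler_wpM2r //.
by have := cS n; lra.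
Qed.

End ComplexModulus.

(** * The complex exponential *)

Section Exponential.
Variable R : realType.
Implicit Types (z w : R[i]) (x y : R).

Lemma cexpD z w : cexp (z + w) = cexp z * cexp w.
Proof.
case: z w => [a b] [c d]; rewrite /cexp /= expRD cosD sinD.
by apply/eqP; rewrite eq_complex /=; apply/andP; split; apply/eqP; ring.
Qed.

Lemma cexp0 : cexp 0 = 1 :> R[i].
Proof. by rewrite /cexp /= expR0 cos0 sin0 mulr1 mulr0. Qed.

Lemma cexpN_mul z : cexp (- z) * cexp z = 1.
Proof. by rewrite -cexpD addNr cexp0. Qed.

Lemma cexp_neq0 z : cexp z != 0.
Proof.
by apply: contra_eq_neq (cexpN_mul z) => ->; rewrite mulr0 eq_sym oner_neq0.
Qed.

Lemma cexpN z : cexp (- z) = (cexp z)^-1.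
Proof. by apply: (mulIf (cexp_neq0 z)); rewrite cexpN_mul mulVf ?cexp_neq0. Qed.

Lemma cpowD x z w : cpow x (z + w) = cpow x z * cpow x w.
Proof. by rewrite /cpow mulrDl cexpD. Qed.

Lemma cpowN x z : cpow x (- z) = (cpow x z)^-1.
Proof. by rewrite /cpow mulNr cexpN. Qed.

Lemma cpow_neq0 x z : cpow x z != 0.
Proof. exact: cexp_neq0. Qed.

Lemma cpowM x y z : 0 < x -> 0 < y -> cpow (x * y) z = cpow x z * cpow y z.
Proof.
by move=> x0 y0; rewrite /cpow lnM ?posrE // rmorphD mulrDr cexpD.
Qed.

Lemma cpowV x z : 0 < x -> cpow x^-1 z = (cpow x z)^-1.
Proof.
by move=> x0; rewrite /cpow lnV ?posrE // rmorphN mulrN cexpN.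
Qed.

Lemma cpow1x z : cpow 1 z = 1 :> R[i].
Proof. by rewrite /cpow ln1 mulr0 cexp0. Qed.

Lemma cpowx1 x : 0 < x -> cpow x 1 = x%:C.
Proof.
move=> x0; rewrite /cpow mul1r /cexp /= lnK ?posrE // cos0 sin0.
by rewrite mulr1 mulr0.
Qed.

(** The mean value theorem for the sine between 0 and [y]. *)
Lemma sin_mvt y : exists2 c : R, `|c| <= `|y| & sin y = y * cos c.
Proof.
wlog y0 : y / 0 <= y.
  move=> H; case: (leP 0 y) => [/H //|y0].
  have [|c cy e] := H (- y); first by lra.
  by exists c; [rewrite -(normrN y) | apply: oppr_inj; rewrite -sinN e mulNr].
have [|c c0y e] := @MVT_segment R sin cos 0 y y0.
  by apply: continuous_subspaceT => x; exact: continuous_sin.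
move: c0y; rewrite in_itv /= => /andP[c0 cy]; exists c.
  by rewrite !ger0_norm.
by move: e; rewrite sin0 !subr0 mulrC.
Qed.

Lemma ler_abs_sin y : `|sin y| <= `|y|.
Proof.
have [c _ ->] := sin_mvt y.
by rewrite normrM ler_piMr // cos_max.
Qed.

Lemma ler_abs_cosB1 y : `|cos y - 1| <= y ^+ 2 / 2.
Proof.
have -> : cos y - 1 = - (2 * sin (y / 2) ^+ 2).
  rewrite [in cos y](_ : y = (y / 2) *+ 2) ?cos_mulr2n;
    last by rewrite mulr2n; lra.
  by have := cos2Dsin2 (y / 2); rewrite mulr2n; lra.
rewrite normrN normrM normrX ger0_norm //.
have := ler_abs_sin (y / 2).
have := normr_ge0 (sin (y / 2)).
have -> : y ^+ 2 = `|y| ^+ 2 by rewrite real_normK ?num_real.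
rewrite normrM [`|2^-1|]ger0_norm ?invr_ge0 // => h1 h2.
by nra.
Qed.

Lemma ler_abs_sinB y : `|sin y - y| <= `|y| * (y ^+ 2 / 2).
Proof.
have [c cy ->] := sin_mvt y.
rewrite -{2}[y]mulr1 -mulrBr normrM ler_wpM2l //.
apply: le_trans (ler_abs_cosB1 c) _.
rewrite ler_wpM2r ?invr_ge0 // -[c ^+ 2]real_normK ?num_real //.
by rewrite -[leRHS]real_normK ?num_real // lerXn2r ?nnegrE.
Qed.

Lemma ler_abs_expRB1 x : `|x| <= 2^-1 -> `|expR x - 1 - x| <= 2 * x ^+ 2.
Proof.
rewrite ler_norml => /andP[h1 h2].
have := expR_ge1Dx x; have := expR_ge1Dx (- x); rewrite expRN => a b.
rewrite ger0_norm; last lra.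
have e0 := expR_gt0 x.
have : expR x * (1 - x) <= 1.
  by rewrite -[leRHS](mulfV (lt0r_neq0 e0)) ler_wpM2l //; exact: ltW.
by nra.
Qed.

Lemma cexp_taylor w : normc w <= 2^-1 ->
  normc (cexp w - 1 - w) <= 4 * normc w ^+ 2.
Proof.
move=> w12.
have := le_trans (ler_Re_normc w) w12; have := le_trans (ler_Im_normc w) w12.
have w2 : normc w ^+ 2 = complex.Re w ^+ 2 + complex.Im w ^+ 2.
  by case: w {w12} => a b; rewrite /= sqr_sqrtr // addr_ge0 ?sqr_ge0.
rewrite w2; case: w {w2 w12} => x y hy hx.
rewrite [complex.Re _]/= [complex.Im _]/= in hy hx *.
apply: le_trans (normc_le_ReIm _) _ => /=.
have he := ler_abs_expRB1 hx.
have hc := ler_abs_cosB1 y.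
have hs := ler_abs_sin y.
have hS := ler_abs_sinB y.
have hre : `|expR x * cos y - 1 - x| <= 2 * x ^+ 2 + 3 / 4 * y ^+ 2.
  have -> : expR x * cos y - 1 - x =
    (expR x - 1 - x) * cos y + (1 + x) * (cos y - 1) by ring.
  apply: le_trans (ler_normD _ _) _; rewrite !normrM.
  have c1 := cos_max y.
  have : `|1 + x| <= 3 / 2.
    by apply: le_trans (ler_normD _ _) _; rewrite normr1; lra.
  have := normr_ge0 (expR x - 1 - x); have := normr_ge0 (cos y - 1).
  have := normr_ge0 (cos y); have := normr_ge0 (1 + x).
  by move=> *; apply: lerD; nra.
have him : `|expR x * sin y - 0 - y| <= 2 * `|x| * `|y| + y ^+ 2 / 4.
  have -> : expR x * sin y - 0 - y = (expR x - 1) * sin y + (sin y - y) by ring.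
  apply: le_trans (ler_normD _ _) _; rewrite normrM.
  have : `|expR x - 1| <= 2 * `|x|.
    have -> : expR x - 1 = (expR x - 1 - x) + x by ring.
    apply: le_trans (ler_normD _ _) _.
    have x0 := normr_ge0 x.
    by move: he; rewrite -[x ^+ 2]real_normK ?num_real // => he; nra.
  move=> h; apply: lerD.
    by apply: ler_pM.
  apply: le_trans hS _.
  have y0 := normr_ge0 y; have := sqr_ge0 y; nra.
apply: le_trans (lerD hre _) _; first exact: him.
rewrite -[x ^+ 2]real_normK ?num_real // -[y ^+ 2]real_normK ?num_real //.
have := sqr_ge0 (`|x| - `|y|); have := sqr_ge0 `|x|; have := sqr_ge0 `|y|.
by nra.
Qed.

End Exponential.

(** * Gauss's limit for the gamma function *)

Section GammaFunction.
Variable R : realType.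
Implicit Types (z w : R[i]) (x y : R).

Lemma lim_eventually_cst (u : nat -> R[i]) (l : R[i]) (N : nat) :
  (forall n, (N <= n)%N -> u n = l) ->
  (lim ((u : nat -> R[i]^o) @ \oo))%classic = l.
Proof.
move=> ul; apply: cvg_lim; first exact: norm_hausdorff.
apply: cvg_near_cst; exists N => // n /= Nn; exact: ul.
Qed.

(** The terms of Gauss's limit for [Gamma]. *)
Definition gauss z (n : nat) : R[i] :=
  (n`!)%:R * cpow n%:R z / \prod_(k < n.+1) (z + k%:R).

Lemma GammaE z : Gamma z = lim (((gauss z : nat -> R[i]^o) @ \oo)%classic).
Proof. by []. Qed.

(** From the index of the pole on, the terms of Gauss's sequence are quotients
    by 0. *)
Lemma Gamma_at_pole z : Gamma_pole z -> Gamma z = 0.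
Proof.
move=> [m ->]; rewrite GammaE.
apply: (@lim_eventually_cst _ _ m) => n mn.
rewrite /gauss (bigD1 (Ordinal (mn : (m < n.+1)%N))) //= addNr mul0r.
by rewrite invr0 mulr0.
Qed.

Lemma gauss_prod_neq0 z (n : nat) : ~ Gamma_pole z ->
  \prod_(k < n) (z + k%:R) != 0.
Proof.
move=> zP; apply/prodf_neq0 => k _; apply: contra_notN zP => /eqP h.
by exists k; apply/eqP; rewrite -addr_eq0 h.
Qed.

Lemma gauss_neq0 z n : ~ Gamma_pole z -> gauss z n != 0.
Proof.
move=> zP.
by rewrite /gauss !mulf_neq0 ?cpow_neq0 ?invr_neq0 ?gauss_prod_neq0 //.
Qed.

Lemma gauss_ratio z (n : nat) : (0 < n)%N ->
  (gauss z n.+1)^-1 =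
  (gauss z n)^-1 *
  ((1 + z / n.+1%:R) * cexp (- z * (ln (n.+1%:R / n%:R : R))%:C)).
Proof.
move=> n0.
have n0R : 0 < n%:R :> R by rewrite ltr0n.
have nS : n.+1%:R = n%:R * (n.+1%:R / n%:R) :> R.
  by rewrite mulrCA mulfV ?mulr1 // gt_eqF.
have E : cpow n.+1%:R z = cpow n%:R z * cpow (n.+1%:R / n%:R : R) z.
  by rewrite {1}nS cpowM // divr_gt0 // ltr0n.
rewrite mulNr cexpN -/(cpow _ _) /gauss E factS natrM big_ord_recr /= !invfM.
rewrite !invrK; have nz : n.+1%:R != 0 :> R[i] by rewrite pnatr_eq0.
have -> : z + n.+1%:R = n.+1%:R * (1 + z / n.+1%:R) by field.
set p := \prod_(_ < _) _.
set a := (1 + _); set b := (cpow _ _)^-1; set c := (cpow _ _)^-1.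
set f := (n`!%:R)^-1.
transitivity ((n.+1%:R)^-1 * n.+1%:R * f * b * c * p * a); first by ring.
by rewrite mulVf //; ring.
Qed.

(** The inverse ratio of Gauss's sequence is 1 + O(1 / m ^ 2), since
    [C / m - C / (m + 1) = C / (m * (m + 1))]. The second bound keeps the ratio
    away from 0. *)
Lemma gauss_ratio_bound z : exists (C : R) (N : nat),
  [/\ 0 < C, (0 < N)%N & forall m, (N <= m)%N ->
   normc ((1 + z / m.+1%:R) * cexp (- z * (ln (m.+1%:R / m%:R : R))%:C) - 1)
   <= C / m%:R - C / m.+1%:R /\ C / m%:R - C / m.+1%:R <= 2^-1].
Proof.
(* With i = 1 / m, j = 1 / (m + 1) and L = ln ((m + 1) / m), one has
   j <= L <= i and i - j = i * j; the constant C collects the coefficients of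
   i * j in the bounds of the three terms of the expansion below. *)
pose r := normc z; have r0 : 0 <= r := normc_ge0 z.
pose C := 1 + r + r ^+ 2 + (1 + r) * (8 * r ^+ 2).
have C0 : 0 < C by rewrite /C; have := sqr_ge0 r; nra.
have C2 : 2 * r <= 2 * C by rewrite /C; have := sqr_ge0 r; nra.
exists C, (Num.bound (2 * C)).+1; split=> // m Nm.
have mC : 2 * C < m%:R.
  apply: (@lt_trans _ _ (Num.bound (2 * C))%:R); last by rewrite ltr_nat.
  by apply: archi_boundP; lra.
have m0 : 0 < m%:R :> R by lra.
pose i := (m%:R : R)^-1; pose j := (m.+1%:R : R)^-1.
have i0 : 0 < i by rewrite invr_gt0.
have mi : m%:R * i = 1 by rewrite /i mulfV // gt_eqF.
have j0 : 0 < j by rewrite invr_gt0 ltr0n.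
have mj : (1 + m%:R) * j = 1 by rewrite nat1r /j mulfV // pnatr_eq0.
have j1 : j < 1 by have := mulr_gt0 m0 j0; lra.
have ij : i - j = i * j by nra.
pose L := ln (m.+1%:R / m%:R : R).
have Lle : L <= i.
  have -> : L = ln (1 + i).
    by rewrite /L -nat1r mulrDl mul1r mulfV ?gt_eqF // addrC.
  by apply: le_ln1Dx; lra.
have Lge : j <= L.
  have -> : L = - ln (1 + - j).
    rewrite -lnV ?posrE; last by nra.
    congr ln; rewrite -/i -/j.
    have -> : 1 + - j = m%:R * j by lra.
    by rewrite invfM /j invrK mulrC.
  by have := @le_ln1Dx R (- j); lra.
split; last first.
  have -> : C / m%:R - C / m.+1%:R = C * (i * j) by rewrite -mulrBr -ij.
  by nra.
have -> : C / m%:R - C / m.+1%:R = C * (i * j) by rewrite -mulrBr -ij.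
have jC : z / m.+1%:R = z * j%:C by rewrite /j fmorphV /= rmorph_nat.
rewrite -/L jC.
have nL : normc (- z * L%:C) = r * L.
  by rewrite ComplexField.Normc.normcM normcN normcC ger0_norm //; lra.
have hT : normc (cexp (- z * L%:C) - 1 - - z * L%:C) <= 4 * (r * L) ^+ 2.
  rewrite -nL; apply: cexp_taylor; rewrite nL.
  have Ci : 2 * C * i < 1 by nra.
  have ri : r * i <= C * i by rewrite ler_wpM2r; lra.
  have := ler_wpM2l r0 Lle; lra.
set E := cexp _ - 1 - _ in hT.
have -> : cexp (- z * L%:C) = 1 - z * L%:C + E by rewrite /E; ring.
(* The first-order terms z * j and - z * L cancel up to z * (j - L). *)
have -> : (1 + z * j%:C) * (1 - z * L%:C + E) - 1 =
   z * (j - L)%:C + (- (z * z * (L * j)%:C)) + (1 + z * j%:C) * E.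
  by rewrite rmorphB rmorphM; ring.
apply: le_trans (ler_normcD _ _) _.
apply: le_trans (lerD (ler_normcD _ _) (lexx _)) _.
rewrite normcN !ComplexField.Normc.normcM !normcC -/r.
have h1 : `|j - L| <= i * j by rewrite ler0_norm; lra.
have h2 : `|L * j| <= i * j by rewrite ger0_norm; nra.
have h3 : normc (1 + z * j%:C) <= 1 + r.
  apply: le_trans (ler_normcD _ _) _.
  rewrite ComplexField.Normc.normc1 ComplexField.Normc.normcM normcC -/r.
  by rewrite ger0_norm; nra.
have h4 : normc E <= 8 * r ^+ 2 * (i * j).
  apply: le_trans hT _.
  have i1 : i <= 1 by rewrite invf_le1 // ler1n -(ltr0n R).
  have i2j : i <= 2 * j by have := ler_wpM2r (ltW j0) i1; lra.
  have L2 : L ^+ 2 <= 2 * (i * j).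
    apply: le_trans (_ : i * i <= _);
      last by have := ler_wpM2l (ltW i0) i2j; lra.
    by rewrite expr2 ler_pM //; lra.
  by have := ler_wpM2l (sqr_ge0 r) L2; rewrite exprMn; lra.
have h5 : r * `|j - L| <= r * (i * j) by rewrite ler_wpM2l.
have h6 : r * r * `|L * j| <= r ^+ 2 * (i * j).
  by rewrite -expr2 ler_wpM2l ?sqr_ge0.
have h7 : normc (1 + z * j%:C) * normc E <= (1 + r) * (8 * r ^+ 2 * (i * j)).
  by apply: ler_pM => //; exact: normc_ge0.
have h8 : 0 <= i * j by nra.
rewrite /C; lra.
Qed.

Lemma gauss_cvg_neq0 z : ~ Gamma_pole z ->
  exists l : R[i]^o, l != 0 /\ ((gauss z : nat -> R[i]^o) @ \oo --> l)%classic.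
Proof.
move=> zP; have [C [N [C0 N0 hN]]] := gauss_ratio_bound z.
(* The estimate holds from N on, so the shifted sequence g is considered. *)
pose c (n : nat) : R := C / (n + N)%:R.
pose g n := gauss z (n + N).
have g0 n : g n != 0 by exact: gauss_neq0.
have c0 n : 0 <= c n by rewrite /c divr_ge0 // ltW.
have cS n : c n.+1 <= c n.
  rewrite /c ler_pM2l // lef_pV2 ?posrE ?ltr0n ?ler_nat ?addSn //.
    exact: leq_trans N0 (leq_addl _ _).
pose u n := (1 + z / (n + N).+1%:R) *
  cexp (- z * (ln ((n + N).+1%:R / (n + N)%:R : R))%:C) - 1.
have hu n : normc (u n) <= c n - c n.+1 /\ c n - c n.+1 <= 2^-1.
  exact: hN (leq_addl _ _).
have gV n : (g n.+1)^-1 = (g n)^-1 * (1 + u n).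
  rewrite /g addSn gauss_ratio; last exact: leq_trans N0 (leq_addl _ _).
  by rewrite /u [1 + (_ - 1)]addrC subrK.
have [a ha] : exists l : R[i]^o,
    ((fun n => (g n)^-1 : R[i]^o) @ \oo --> l)%classic.
  apply: (@cvg_complex_product R (fun n => (g n)^-1) c) => // n.
  rewrite gV mulrDr mulr1 [_ + _ * _]addrC addrK ComplexField.Normc.normcM.
  by rewrite ler_wpM2l ?normc_ge0 //; case: (hu n).
have [b hb] : exists l : R[i]^o, ((g : nat -> R[i]^o) @ \oo --> l)%classic.
  apply: (@cvg_complex_product R g (fun n => 2 * c n)) => [n|n|n].
  - by rewrite mulr_ge0.
  - have [h1 h2] := hu n.
    have gE : g n = g n.+1 * (1 + u n).
      rewrite -[1 + u n](mulKf (invr_neq0 (g0 n))) -gV invrK mulrCA.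
      by rewrite mulfV ?mulr1.
    have h12 : 2^-1 <= normc (1 + u n).
      have : normc (1 + u n - u n) <= normc (1 + u n) + normc (u n).
        by apply: le_trans (ler_normcD _ _) _; rewrite normcN.
      by rewrite addrK ComplexField.Normc.normc1; lra.
    move: (g n) (g n.+1) gE => y x ->.
    have -> : x - x * (1 + u n) = - (x * u n) by ring.
    rewrite normcN !ComplexField.Normc.normcM -mulrA.
    by rewrite ler_wpM2l ?normc_ge0 //; have := normc_ge0 (u n); nra.
  - by have := cS n; lra.
exists b; split; last by rewrite -(@cvg_shiftn N).
(* the limits of g and of its inverse have product 1 *)
have ab :
  ((fun n => (g n)^-1 * g n : R[i]^o) @ \oo --> (a * b : R[i]^o))%classic.
  exact: cvgM ha hb.
have ab1 : a * b = 1.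
  rewrite -(cvg_lim (@norm_hausdorff _ _) ab).
  by apply: (@lim_eventually_cst _ _ 0) => n _; rewrite mulVf.
by apply: contra_eq_neq ab1 => ->; rewrite mulr0 eq_sym oner_neq0.
Qed.

Lemma Gamma_neq0 z : ~ Gamma_pole z -> Gamma z != 0.
Proof.
move=> /gauss_cvg_neq0[l [l0 hl]].
by rewrite GammaE (cvg_lim (@norm_hausdorff _ _) hl).
Qed.

Lemma gauss_shift z (n : nat) : ~ Gamma_pole z -> ~ Gamma_pole (z + 1) ->
  (0 < n)%N ->
  gauss (z + 1) n = z * gauss z n * (1 + (z + 1) / n%:R)^-1.
Proof.
move=> zP z1P n0; rewrite /gauss cpowD cpowx1 ?ltr0n // rmorph_nat.
have z0 : z != 0.
  by apply: contra_notN zP => /eqP ->; exists 0%N; rewrite oppr0.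
have E : \prod_(k < n.+1) (z + k%:R) * (z + n.+1%:R) =
         z * \prod_(k < n.+1) (z + 1 + k%:R).
  transitivity (\prod_(k < n.+2) (z + k%:R)).
    by rewrite [RHS]big_ord_recr.
  rewrite big_ord_recl addr0; congr (_ * _); apply: eq_bigr => k _.
  by rewrite -addrA nat1r.
have nz : n%:R != 0 :> R[i] by rewrite pnatr_eq0 -lt0n.
have p0 := gauss_prod_neq0 n.+1 zP; have p1 := gauss_prod_neq0 n.+1 z1P.
have zn0 : z + n.+1%:R != 0.
  apply: contra_notN zP => h; exists n.+1.
  by apply/eqP; rewrite -addr_eq0.
have -> : 1 + (z + 1) / n%:R = (z + n.+1%:R) / n%:R.
  by rewrite -nat1r; field.
set p := \prod_(_ < _) _ in E p0 *; set q := \prod_(_ < _) _ in E p1 *.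
have -> : q = p * (z + n.+1%:R) / z by rewrite E mulrC mulKf.
by field; rewrite nat1r zn0 z0 p0 nz.
Qed.

Lemma GammaS z : ~ Gamma_pole z -> Gamma (z + 1) = z * Gamma z.
Proof.
move=> zP.
have z1P : ~ Gamma_pole (z + 1).
  move=> [k zk]; apply: zP; exists k.+1.
  by rewrite -natr1 opprD -zk addrK.
have [l [_ hl]] := gauss_cvg_neq0 zP; have [l' [_ hl']] := gauss_cvg_neq0 z1P.
rewrite !GammaE (cvg_lim (@norm_hausdorff _ _) hl).
suff h : ((gauss (z + 1) : nat -> R[i]^o) @ \oo --> (z * l : R[i]^o))%classic.
  by rewrite (cvg_lim (@norm_hausdorff _ _) h).
have hn : ((fun n : nat => n.+1%:R^-1 : R[i]^o) @ \oo --> (0 : R[i]^o))%classic.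
  have := @cvg_ReIm R (fun n => n.+1%:R^-1) 0 0; apply.
  - under eq_fun do rewrite -(rmorph_nat (real_complex R)) -fmorphV /=.
    exact: cvg_harmonic.
  - under eq_fun do rewrite -(rmorph_nat (real_complex R)) -fmorphV /=.
    exact: cvg_cst.
have cvg_scale (a m : R[i]^o) (u : nat -> R[i]^o) : (u @ \oo --> m)%classic ->
    ((fun n => a * u n : R[i]^o) @ \oo --> (a * m : R[i]^o))%classic.
  by move=> um; apply: cvgM um; exact: cvg_cst.
have hd : ((fun n : nat => 1 + (z + 1) * n.+1%:R^-1 : R[i]^o) @ \oo
    --> (1 + (z + 1) * 0 : R[i]^o))%classic.
  by apply: cvgD; [exact: cvg_cst | exact: (cvg_scale (z + 1) _ _ hn)].
have hdV : ((fun n : nat => (1 + (z + 1) * n.+1%:R^-1)^-1 : R[i]^o) @ \oo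
    --> ((1 + (z + 1) * 0)^-1 : R[i]^o))%classic.
  have d0 : 1 + (z + 1) * 0 != 0 :> R[i] by rewrite mulr0 addr0 oner_neq0.
  exact: (cvgV d0 hd).
have hzl : ((fun n : nat => z * gauss z n.+1 : R[i]^o) @ \oo
    --> (z * l : R[i]^o))%classic.
  rewrite -(cvg_shiftS (gauss z : nat -> R[i]^o)) in hl.
  exact: (cvg_scale z _ _ hl).
have hs : ((fun n : nat =>
    z * gauss z n.+1 * (1 + (z + 1) * n.+1%:R^-1)^-1 : R[i]^o)
   @ \oo --> (z * l * (1 + (z + 1) * 0)^-1 : R[i]^o))%classic.
  exact: cvgM hzl hdV.
rewrite -(cvg_shiftS (gauss (z + 1) : nat -> R[i]^o)).
have -> : z * l = z * l * (1 + (z + 1) * 0)^-1.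
  by rewrite mulr0 addr0 invr1 mulr1.
apply: cvg_trans hs; apply: near_eq_cvg; apply: nearW => n /=.
by rewrite gauss_shift.
Qed.

End GammaFunction.

(** * Kernels as products over lists of parameters *)

Section ListProducts.
Variables (K : comPzRingType) (F : K -> K).
Implicit Types (s : seq K) (n : nat).

Lemma prod_nth_take s n : (n <= size s)%N ->
  \prod_(0 <= j < n) F s`_j = \prod_(x <- take n s) F x.
Proof.
move=> ns; rewrite [RHS](big_nth 0) size_takel //.
by apply: eq_big_nat => j /andP[_ jn]; rewrite nth_take.
Qed.

Lemma prod_nth_drop s n :
  \prod_(n <= j < size s) F s`_j = \prod_(x <- drop n s) F x.
Proof.
rewrite [RHS](big_nth 0) size_drop -{1}[n]add0n big_addn.
by apply: eq_big_nat => j _; rewrite nth_drop addnC.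
Qed.

End ListProducts.

Section Kernels.
Variables (R : realType) (tau : R) (G : R[i] -> R[i]).
Implicit Types (k : kernel_params R) (s z c alpha : R[i]).

Lemma kernel_numE k s : kernel_num tau G k s =
  (\prod_(b <- take (km k) (kb k)) G (b - s)) *
  (\prod_(a <- take (kn k) (ka k)) G (1 + tau%:C - a + s)).
Proof.
by rewrite /kernel_num (prod_nth_take (fun b => G (b - s)) (km_le k))
  (prod_nth_take (fun a => G (1 + tau%:C - a + s)) (kn_le k)).
Qed.

Lemma kernel_denE k s : kernel_den tau G k s =
  (\prod_(b <- drop (km k) (kb k)) G (1 + tau%:C - b + s)) *
  (\prod_(a <- drop (kn k) (ka k)) G (a - s)).
Proof.
by rewrite /kernel_den (prod_nth_drop (fun b => G (1 + tau%:C - b + s)))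
  (prod_nth_drop (fun a => G (a - s))).
Qed.

Lemma take_rcons_le (T : Type) (l : seq T) (n : nat) x :
  (n <= size l)%N -> take n (rcons l x) = take n l.
Proof. by move=> nl; rewrite -cats1 takel_cat. Qed.

Lemma kernel_num_a_num c k s : kernel_num tau G (add_a_num c k) s =
  kernel_num tau G k s * G (1 + tau%:C - c + s).
Proof. by rewrite !kernel_numE /= big_cons mulrCA mulrC. Qed.

Lemma kernel_num_b_num c k s : kernel_num tau G (add_b_num c k) s =
  kernel_num tau G k s * G (c - s).
Proof. by rewrite !kernel_numE /= big_cons -mulrA mulrC. Qed.

Lemma kernel_num_a_den c k s :
  kernel_num tau G (add_a_den c k) s = kernel_num tau G k s.
Proof. by rewrite !kernel_numE /= take_rcons_le ?kn_le. Qed.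

Lemma kernel_num_b_den c k s :
  kernel_num tau G (add_b_den c k) s = kernel_num tau G k s.
Proof. by rewrite !kernel_numE /= take_rcons_le ?km_le. Qed.

Lemma kernel_den_a_num c k s :
  kernel_den tau G (add_a_num c k) s = kernel_den tau G k s.
Proof. by rewrite !kernel_denE. Qed.

Lemma kernel_den_b_num c k s :
  kernel_den tau G (add_b_num c k) s = kernel_den tau G k s.
Proof. by rewrite !kernel_denE. Qed.

Lemma kernel_den_a_den c k s : kernel_den tau G (add_a_den c k) s =
  kernel_den tau G k s * G (c - s).
Proof.
by rewrite !kernel_denE /= drop_rcons ?kn_le // -cats1 big_cat big_seq1 /=
  mulrA.
Qed.

Lemma kernel_den_b_den c k s : kernel_den tau G (add_b_den c k) s =
  kernel_den tau G k s * G (1 + tau%:C - c + s).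
Proof.
by rewrite !kernel_denE /= drop_rcons ?km_le // -cats1 big_cat big_seq1 /=
  mulrAC.
Qed.

Lemma take_cat_blocks (T : Type) (n1 n2 : nat) (l1 l2 : seq T) :
  (n1 <= size l1)%N -> (n2 <= size l2)%N ->
  take (n1 + n2) (cat_blocks n1 n2 l1 l2) = take n1 l1 ++ take n2 l2.
Proof.
by move=> h1 h2; apply: take_size_cat; rewrite size_cat !size_takel.
Qed.

Lemma drop_cat_blocks (T : Type) (n1 n2 : nat) (l1 l2 : seq T) :
  (n1 <= size l1)%N -> (n2 <= size l2)%N ->
  drop (n1 + n2) (cat_blocks n1 n2 l1 l2) = drop n1 l1 ++ drop n2 l2.
Proof.
by move=> h1 h2; apply: drop_size_cat; rewrite size_cat !size_takel.
Qed.

Lemma K_kernelM alpha1 alpha2 k1 k2 s :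
  K_kernel tau G alpha1 k1 s * K_kernel tau G alpha2 k2 s =
  K_kernel tau G (alpha1 + alpha2) (cat_params k1 k2) s.
Proof.
rewrite /K_kernel.
have -> : kernel_num tau G (cat_params k1 k2) s =
  kernel_num tau G k1 s * kernel_num tau G k2 s.
  rewrite !kernel_numE /= !take_cat_blocks ?km_le ?kn_le // !big_cat /=.
  by rewrite mulrACA.
have -> : kernel_den tau G (cat_params k1 k2) s =
  kernel_den tau G k1 s * kernel_den tau G k2 s.
  rewrite !kernel_denE /= !drop_cat_blocks ?km_le ?kn_le // !big_cat /=.
  by rewrite mulrACA.
have -> : pi%:C * (alpha1 + alpha2) * s ^+ 2 / tau%:C =
  pi%:C * alpha1 * s ^+ 2 / tau%:C + pi%:C * alpha2 * s ^+ 2 / tau%:C by ring.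
by rewrite cexpD [in RHS]invfM; ring.
Qed.

(** * The insertion rules *)

(** The argument at which the factor evaluates [Gamma]. *)
Definition factor_arg (f : gamma_factor R) s : R[i] :=
  match f with
  | GammaMinus c | InvGammaMinus c => c - s
  | GammaPlus c | InvGammaPlus c => c + s
  end.

(** The value of [G] which the insertion rule for the factor adds to the
    numerator of the kernel. *)
Definition factor_num (f : gamma_factor R) s : R[i] :=
  match f with
  | GammaMinus _ | GammaPlus _ => G (factor_arg f s + tau%:C)
  | InvGammaMinus _ | InvGammaPlus _ => G (factor_arg f s)
  end.

(** The value of [G] which the insertion rule for the factor adds to the
    denominator of the kernel. *)
Definition factor_den (f : gamma_factor R) s : R[i] :=
  match f with
  | GammaMinus _ | GammaPlus _ => G (factor_arg f s)
  | InvGammaMinus _ | InvGammaPlus _ => G (factor_arg f s + tau%:C)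
  end.

Lemma kernel_num_rule f k s : kernel_num tau G (rule_params tau f k) s =
  kernel_num tau G k s * factor_num f s.
Proof.
case: f => c; rewrite /rule_params
  ?(kernel_num_a_num, kernel_num_b_num, kernel_num_a_den, kernel_num_b_den) /=;
  congr (_ * G _); ring.
Qed.

Lemma kernel_den_rule f k s : kernel_den tau G (rule_params tau f k) s =
  kernel_den tau G k s * factor_den f s.
Proof.
case: f => c; rewrite /rule_params
  ?(kernel_den_a_num, kernel_den_b_num, kernel_den_a_den, kernel_den_b_den) /=;
  congr (_ * G _); ring.
Qed.

Hypothesis tau_gt0 : 0 < tau.
Hypothesis G_barnes : is_double_gamma tau G.

(** The factor with indices k = 0 and l = m vanishes at z = - m, and for m = 0
    the factor z does. *)
Lemma barnes_product_at_pole (c1 c2 : R) z :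
  Gamma_pole z -> barnes_product tau c1 c2 z = 0.
Proof.
move=> [[|m] ->]; first by rewrite /barnes_product oppr0 !mul0r.
rewrite /barnes_product (@lim_eventually_cst _ _ 0 m.+2) ?mulr0 // => n mn.
rewrite (bigD1 (Ordinal (leq_ltn_trans (leq0n _) mn))) //=.
rewrite (bigD1 (Ordinal (mn : (m.+1 < n)%N))) //=.
by rewrite mul0r add0r /barnes_factor mulNr mulfV ?pnatr_eq0 // subrr !mul0r.
Qed.

Lemma G_at_pole z : Gamma_pole z -> G z = 0.
Proof.
by case: G_barnes => c1 [c2 [GE _ _]] zP; rewrite GE barnes_product_at_pole.
Qed.

Lemma G_shift z : ~ Gamma_pole z ->
  G (z + tau%:C) = (kappa tau)^-1 * cpow tau (2^-1 - z) * Gamma z * G z.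
Proof.
case: G_barnes => c1 [c2 [_ _ GS]] zP; rewrite GS //; congr (_ * _ * _ * _).
by rewrite /kappa -cpowN -rmorphN; congr (cpow _ _%:C); lra.
Qed.

Lemma GammaE_G z : ~ Gamma_pole z -> G z != 0 ->
  Gamma z = kappa tau * cpow tau (z - 2^-1) * (G (z + tau%:C) / G z).
Proof.
move=> zP Gz; rewrite G_shift // -[z - _]opprB cpowN.
by field; rewrite Gz !cpow_neq0.
Qed.

(** Unlike [GammaE_G], this holds at the poles of [Gamma] too, where both sides
    vanish. *)
Lemma invGammaE_G z : G (z + tau%:C) != 0 ->
  (Gamma z)^-1 = (kappa tau)^-1 * cpow tau (2^-1 - z) * (G z / G (z + tau%:C)).
Proof.
have [zP _|zP] := pselect (Gamma_pole z).
  by rewrite Gamma_at_pole // G_at_pole // mul0r mulr0 invr0.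
rewrite G_shift // !mulf_eq0 !negb_or invr_eq0 -!andbA => /and4P[k0 c0 g0 G0].
by field; rewrite G0 g0 k0 c0.
Qed.

Lemma rule_lambda_gt0 f : 0 < rule_lambda tau f.
Proof. by case: f => c; rewrite /= ?invr_gt0. Qed.

(** The four insertion rules, as an identity between one factor and the
    quotient of the two values of [G] which it inserts. *)
Lemma factor_evalE f s : factor_regular f s -> factor_den f s != 0 ->
  factor_eval f s =
  rule_C tau f * cpow (rule_lambda tau f) (- s) *
  (factor_num f s / factor_den f s).
Proof.
case: f => c /= freg Gne0;
  rewrite ?(GammaE_G freg Gne0) ?(invGammaE_G Gne0); congr (_ * _);
  rewrite -[RHS]mulrA; congr (_ * _);
  rewrite ?cpowV // -?cpowN -cpowD; congr cpow; ring.
Qed.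

Lemma factor_evalM_K_kernel alpha f k s : factor_regular f s ->
  kernel_den tau G (rule_params tau f k) s != 0 ->
  factor_eval f s * K_kernel tau G alpha k s =
  rule_C tau f * cpow (rule_lambda tau f) (- s) *
  K_kernel tau G alpha (rule_params tau f k) s.
Proof.
move=> freg; rewrite kernel_den_rule mulf_eq0 negb_or => /andP[_ fden].
rewrite factor_evalE // /K_kernel kernel_num_rule kernel_den_rule [in RHS]invfM.
by ring.
Qed.

Lemma insert_lambda_gt0 r : 0 < insert_lambda tau r.
Proof. by apply: prodr_gt0 => f _; exact: rule_lambda_gt0. Qed.

(** A nonzero denominator of the kernel with all parameters inserted forces
    those of the intermediate kernels to be nonzero, so that each factor can be
    inserted in turn. *)
Lemma gamma_productM_K_kernel alpha k r s : gamma_product_regular r s ->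
  kernel_den tau G (insert_params tau r k) s != 0 ->
  gamma_product r s * K_kernel tau G alpha k s =
  insert_C tau r * cpow (insert_lambda tau r) (- s) *
  K_kernel tau G alpha (insert_params tau r k) s.
Proof.
elim: r => [|f r IH] /=.
  by rewrite /gamma_product /insert_C /insert_lambda !big_nil cpow1x !mul1r.
move=> [freg rreg] den0.
have rden0 : kernel_den tau G (insert_params tau r k) s != 0.
  by move: den0; rewrite kernel_den_rule mulf_eq0 negb_or => /andP[].
rewrite /gamma_product big_cons -mulrA -/(gamma_product r s) IH // mulrCA.
rewrite factor_evalM_K_kernel // /insert_C /insert_lambda !big_cons.
rewrite cpowM ?rule_lambda_gt0 //; last exact: insert_lambda_gt0.
by ring.
Qed.

End Kernels.

(** * Multipliers *)

(** This includes s = 0, where [Gamma s] has the dummy value 0. *)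
Lemma Gamma_ratio (R : realType) (s : R[i]) :
  ~ Gamma_pole (s + 1) -> Gamma (s + 1) / Gamma s = s.
Proof.
move=> s1P; have [sP|sP] := pselect (Gamma_pole s); last first.
  by rewrite GammaS // mulfK // Gamma_neq0.
rewrite (Gamma_at_pole sP) invr0 mulr0.
case: sP s1P => [[|m] ->]; first by rewrite oppr0.
by case; exists m; rewrite -natr1 opprD addrNK.
Qed.

Theorem theorem10p2 (R : realType) (tau : R) (tau_gt0 : 0 < tau)
    (G : R[i] -> R[i]) (G_barnes : is_double_gamma tau G) :
  (forall (alpha : R[i]) (k : kernel_params R) (r : seq (gamma_factor R))
      (s : R[i]),
    gamma_product_regular r s ->
    kernel_den tau G k s != 0 ->
    kernel_den tau G (insert_params tau r k) s != 0 ->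
    gamma_product r s * K_kernel tau G alpha k s =
    insert_C tau r * cpow (insert_lambda tau r) (- s) *
    K_kernel tau G alpha (insert_params tau r k) s)
  /\
  [/\ forall gamma delta s : R[i],
        erdelyi_kober_multiplier gamma delta s =
        gamma_product [:: GammaMinus (gamma + 1);
                          InvGammaMinus (gamma + delta + 1)] s,
      forall beta gamma s : R[i],
        euler_multiplier beta gamma s =
        Gamma gamma *
        gamma_product [:: GammaMinus beta; InvGammaMinus (beta + gamma)] s,
      forall s : R[i],
        laplace_multiplier s = gamma_product [:: GammaPlus 0] s /\
        laplace_multiplier (1 - s) = gamma_product [:: GammaMinus 1] s
    & forall s : R[i],
        (~ Gamma_pole (s + 1) ->
           derivative_multiplier s = - (Gamma (s + 1) / Gamma s) /\
           derivative_multiplier s =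
           - 1 * gamma_product [:: GammaPlus 1; InvGammaPlus 0] s) /\
        (~ Gamma_pole (s + 1 + 1) ->
           derivative_multiplier (s + 1) =
           - 1 * gamma_product [:: GammaPlus (1 + 1); InvGammaPlus 1] s)]
  /\
  (forall (alpha1 alpha2 : R[i]) (k1 k2 : kernel_params R) (s : R[i]),
    K_kernel tau G alpha1 k1 s * K_kernel tau G alpha2 k2 s =
    K_kernel tau G (alpha1 + alpha2) (cat_params k1 k2) s).
Proof.
split; first by move=> alpha k r s rreg _; exact: gamma_productM_K_kernel.
split; last by move=> *; exact: K_kernelM.
split=> [gamma delta s|beta gamma s|s|s].
- by rewrite /gamma_product !big_cons big_nil mulr1.
- by rewrite /gamma_product !big_cons big_nil mulr1.
- by rewrite /gamma_product !big_seq1 /= add0r.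
- rewrite /gamma_product !big_cons big_nil !mulr1 /= add0r !mulN1r.
  split=> [sP|sP].
    by rewrite [1 + s]addrC Gamma_ratio.
  by rewrite [1 + 1 + s]addrC addrA [1 + s]addrC Gamma_ratio.
Qed.
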